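(* Let $n(g)\ge2$ $(g\ge1)$ be integers satisfying $\lim_{g\to\infty}\frac{n(g)}{g}=\infty$, and let $\{G_g\}_{g\ge1}$ be a sequence of connected graphs such that $G_g\in\mathcal F_{g,n(g)}$. Then $$\lim_{g\to\infty}\lambda_1(G_g)=\lim_{g\to\infty}\sigma_1(G_g)=0 .$$
   Context: Graphs are finite; multiple edges are allowed, and loops are allowed at degree-$3$ vertices; a loop contributes $2$ to the degree of its vertex. For non-negative integers $g,n$ with $2g-2+n>0$, $\mathcal F_{g,n}$ is the set of connected graphs $G$ with a decomposition $V(G)=V'(G)\sqcup\delta G$ such that $|V'(G)|=2g-2+n$, $|\delta G|=n$, every vertex of $V'(G)$ has degree $3$ and every vertex of $\delta G$ has degree $1$. The vertices of $\delta G$ are called boundary vertices. Graph Laplacian: for $f:V(G)\to\mathbb R$, $\Delta_Gf(v)=\frac1{\deg(v)}\sum_{w\sim v}(f(w)-f(v))$, the sum being over edges joining $v$ to $w$ (counted with multiplicity; loops contribute $0$). The eigenvalues of $-\Delta_G$, counted with multiplicity, are $0=\lambda_0(G)<\lambda_1(G)\le\lambda_2(G)\le\cdots\le 2$. Steklov problem: for $x\in\delta G$ with unique neighbour $y$, put $\frac{\partial f}{\partial\vec n}(x)=f(x)-f(y)$. A number $\sigma\in\mathbb R$ is a Steklov eigenvalue of $(G,\delta G)$ if there is a nonzero $f:V(G)\to\mathbb R$ with $\Delta_Gf(x)=0$ for all $x\in V(G)\setminus\delta G$ and $\frac{\partial f}{\partial\vec n}(x)=\sigma f(x)$ for all $x\in\delta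 G$. There are $|\delta G|$ Steklov eigenvalues counted with multiplicity, $0=\sigma_0(G)<\sigma_1(G)\le\cdots\le\sigma_{|\delta G|-1}(G)\le 1$. Equivalently, $\sigma_1(G)$ is the minimum of $\sum_{\{x,y\}\in E(G)}(f(x)-f(y))^2\big/\sum_{x\in\delta G}f(x)^2$ over all $f:V(G)\to\mathbb R$ with $f|_{\delta G}\not\equiv0$ and $\sum_{x\in\delta G}f(x)=0$. *)

(* Defs.v *)
From HB Require Import structures.
From mathcomp Require Import all_boot all_order all_algebra.
From mathcomp Require Import all_classical all_reals all_analysis.
From mathcomp Require Import ring.

Set Implicit Arguments.
Unset Strict Implicit.
Unset Printing Implicit Defensive.

Import Order.TTheory GRing.Theory Num.Theory.

Local Open Scope ring_scope.

(* Each edge is listed once, with an arbitrary and irrelevant choice of which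
   endpoint is called [src]; multiple edges and loops ([src e = tgt e]) are
   allowed. *)
Record bgraph := BGraph {
  vert : finType;
  edge : finType;
  src : edge -> vert;
  tgt : edge -> vert;
  bdry : {set vert} }.

Section Graphs.
Variable G : bgraph.

Definition adj : rel (vert G) := fun x y =>
  [exists e : edge G, ((src e == x) && (tgt e == y))
                   || ((src e == y) && (tgt e == x))].

Definition connected_graph : Prop := forall x y : vert G, connect adj x y.

(* A loop is counted once in each summand, hence twice. *)
Definition deg (v : vert G) : nat :=
  (#|[set e : edge G | src e == v]| + #|[set e : edge G | tgt e == v]|)%N.

End Graphs.

(* The truncated subtraction is exact thanks to the first condition. *)
Definition in_F (g n : nat) (G : bgraph) : Prop :=
  (2 < 2 * g + n)%N /\
  connected_graph G /\
  #|~: bdry G| = (2 * g + n - 2)%N /\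
  #|bdry G| = n /\
  (forall v : vert G, v \notin bdry G -> deg v = 3%N) /\
  (forall v : vert G, v \in bdry G -> deg v = 1%N).

Section Operators.
Variables (R : realType) (G : bgraph).

(* A loop at [v] appears in both sums and contributes 0 to each. *)
Definition laplacian (f : vert G -> R) (v : vert G) : R :=
  (deg v)%:R^-1 *
  (\sum_(e : edge G | src e == v) (f (tgt e) - f v)
   + \sum_(e : edge G | tgt e == v) (f (src e) - f v)).

(* For [x] of degree 1 this is the unique neighbour of [x]. *)
Definition neighbour (x : vert G) : vert G := odflt x [pick y | adj x y].

Definition normal_derivative (f : vert G -> R) (x : vert G) : R :=
  f x - f (neighbour x).

Notation fspace := {ffun vert G -> R^o}.

Definition neg_laplacian (f : fspace) : fspace := [ffun v => - laplacian f v].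

Definition steklov_defect (sigma : R) (f : fspace) : fspace :=
  [ffun x => if x \in bdry G then normal_derivative f x - sigma * f x
             else laplacian f x].

Lemma laplacian_linear (a : R) (f h : fspace) (v : vert G) :
  laplacian (a *: f + h) v = a * laplacian f v + laplacian h v.
Proof.
have E (P : pred (edge G)) (k : edge G -> vert G) :
    \sum_(e | P e) ((a *: f + h) (k e) - (a *: f + h) v) =
    a * (\sum_(e | P e) ((f (k e) : R) - f v))
    + \sum_(e | P e) ((h (k e) : R) - h v) :> R.
  rewrite mulr_sumr -big_split; apply: eq_bigr => e _ /=.
  by rewrite !ffunE /= mulrBr opprD addrACA.
by rewrite /laplacian !E; ring.
Qed.

Lemma neg_laplacian_is_linear : linear neg_laplacian.
Proof.
move=> a f h; apply/ffunP => v.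
by rewrite !ffunE laplacian_linear opprD -mulrN.
Qed.
HB.instance Definition _ := GRing.isLinear.Build R fspace fspace *:%R
  neg_laplacian neg_laplacian_is_linear.

Lemma steklov_defect_is_linear sigma : linear (steklov_defect sigma).
Proof.
move=> a f h; apply/ffunP => v.
rewrite !ffunE laplacian_linear; case: ifP => // _.
by rewrite /normal_derivative !ffunE /= /GRing.scale /=; ring.
Qed.
HB.instance Definition _ sigma := GRing.isLinear.Build R fspace fspace *:%R
  (steklov_defect sigma) (steklov_defect_is_linear sigma).

Definition laplace_eigenspace (lam : R) : {vspace fspace} :=
  passmx.leigenspace (linfun neg_laplacian) lam.

Definition steklov_eigenspace (sigma : R) : {vspace fspace} :=
  lker (linfun (steklov_defect sigma)).

Lemma laplace_eigenspaceP (lam : R) (f : fspace) :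
  f \in laplace_eigenspace lam <->
  forall v : vert G, - laplacian f v = lam * f v.
Proof.
rewrite /laplace_eigenspace /passmx.leigenspace memv_ker.
rewrite add_lfunE opp_lfunE scale_lfunE id_lfunE lfunE /= subr_eq0.
split=> [/eqP/ffunP H v | H]; first by have := H v; rewrite !ffunE.
by apply/eqP/ffunP => v; rewrite !ffunE H.
Qed.

Lemma steklov_eigenspaceP (sigma : R) (f : fspace) :
  f \in steklov_eigenspace sigma <->
  (forall x : vert G, x \notin bdry G -> laplacian f x = 0) /\
  (forall x : vert G, x \in bdry G -> normal_derivative f x = sigma * f x).
Proof.
rewrite /steklov_eigenspace memv_ker lfunE /=.
split=> [/eqP/ffunP H | [Hi Hb]].
  split=> x xb; have := H x; rewrite !ffunE.
    by rewrite (negPf xb).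
  by rewrite xb => /eqP; rewrite subr_eq0 => /eqP.
apply/eqP/ffunP => x; rewrite !ffunE.
by case: ifPn => [/Hb-> | /Hi//]; rewrite subrr.
Qed.

End Operators.

(* [s] is the nondecreasing list in which every real [x] occurs exactly
   [mult x] times. *)
Definition ordered_spectrum (R : realType) (mult : R -> nat) (s : seq R) :=
  sorted <=%R s /\ forall x : R, count_mem x s = mult x.

Lemma ordered_spectrum_unique (R : realType) (mult : R -> nat) (s t : seq R) :
  ordered_spectrum mult s -> ordered_spectrum mult t -> s = t.
Proof.
move=> [ss cs] [st ct]; apply: (sorted_eq le_trans le_anti) => //.
by apply/allP => x _ /=; rewrite cs ct.
Qed.

(* The [k]-th eigenvalue (from [k = 0]) counted with multiplicity. If there is
   none the value is -1 and not 0, so that convergence to 0 of eigenvalues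
   cannot come from the default. *)
Definition kth_eigenvalue (R : realType) (mult : R -> nat) (k : nat) : R :=
  nth (-1) (xget [::] [set s | ordered_spectrum mult s]%classic) k.

Definition laplace_eigenvalue (R : realType) (G : bgraph) (k : nat) : R :=
  kth_eigenvalue (fun x : R => \dim (laplace_eigenspace G x)) k.

Definition steklov_eigenvalue (R : realType) (G : bgraph) (k : nat) : R :=
  kth_eigenvalue (fun x : R => \dim (steklov_eigenspace G x)) k.

(* Main.v *)
Require Import Defs.
From mathcomp Require Import all_boot all_order all_algebra.
From mathcomp Require Import all_classical all_reals all_analysis.
From mathcomp Require Import zify ring lra.

(** Both quantities are the second eigenvalue of one generalised problem
    [lap f = x * m * f], where [lap] is the unnormalised Laplacian and [m] is
    a weight on the vertices: the degree for the Laplace spectrum, the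
    indicator of the boundary for the Steklov spectrum. This second eigenvalue
    is at most the Rayleigh quotient of any function of [m]-mean zero, so a
    set [A] of vertices with few edges leaving it, compared with the weight
    of [A] and of its complement, forces it to be small: test on the indicator
    of [A] minus its mean. As [m >= 1] on the boundary, it is enough to find
    [A] whose edge boundary is small compared with the number of boundary
    vertices on either side, and one such [A] serves both spectra.

    Such an [A] exists because the graph is almost a tree: its first Betti
    number is [g], negligible compared with [n]. Connected pieces carrying
    about [8 K] boundary vertices each are peeled off one after the other,
    what is left staying connected ([linked_peel]). A connected piece has at
    least as many inner edges as a tree, so by counting half-edges its edge
    boundary is at most its number of interior vertices minus its number of
    boundary vertices plus 2 ([linked_cut_bdry]). Over the whole graph the
    difference of these two numbers is only [2 g - 2], so the pieces cannot
    all have an edge boundary of more than [1 / K] times their number of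
    boundary vertices ([bdry_le_interior], [sparse_cut]).

    On the analytic side, the minimum of the Rayleigh quotient is attained, by
    compactness ([mass_maximizer]), at a nonconstant eigenfunction
    ([rayleigh_eigen]). Eigenvalues are nonnegative and finitely many, because
    eigenfunctions of distinct eigenvalues are orthogonal for [m]. The
    constants contribute the eigenvalue 0, so that the second entry of the
    ordered spectrum lies between 0 and the Rayleigh quotient
    ([kth_eigenvalue1_bounds], [kth_eigenvalue1_cut]). *)

Set Implicit Arguments.
Unset Strict Implicit.
Unset Printing Implicit Defensive.

Import Order.TTheory GRing.Theory Num.Theory.
Import numFieldNormedType.Exports.

(** * Sparse cuts in graphs that are almost trees *)

Section Cuts.
Variable G : bgraph.
Implicit Types (S A T : {set vert G}) (x y v : vert G).

Definition adj_in S : rel (vert G) :=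
  fun x y => [&& adj x y, x \in S & y \in S].

(** The subgraph induced on [S] is connected, the empty set being allowed. *)
Definition linked S := {in S &, forall x y, connect (adj_in S) x y}.

Definition cut S : nat := #|[set e | (src e \in S) (+) (tgt e \in S)]|.

Definition inner S : nat := #|[set e | (src e \in S) && (tgt e \in S)]|.

Lemma adj_sym x y : adj x y = adj y x.
Proof. by apply: eq_existsb => e; rewrite orbC. Qed.

Lemma adj_in_connect_sym S : connect_sym (adj_in S).
Proof.
apply: sym_connect_sym => x y.
by rewrite /adj_in adj_sym [(x \in S) && _]andbC.
Qed.

(** Each inner edge of [S] has two ends in [S], each edge leaving [S] has
    one. *)
Lemma sum_deg S : (\sum_(v in S) deg v = 2 * inner S + cut S)%N.
Proof.
have count_end (k : edge G -> vert G) :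
    (\sum_(v in S) #|[set e | k e == v]| = \sum_e (k e \in S : nat))%N.
  under eq_bigr do rewrite -sum1dep_card big_mkcond /=.
  rewrite exchange_big /=; apply: eq_bigr => e _.
  have [kS|kS] := boolP (k e \in S).
    rewrite (bigD1 (k e)) //= eqxx big1 // => v /andP[_ /negPf].
    by rewrite eq_sym => ->.
  by rewrite big1 // => v vS; case: eqP => // kv; rewrite kv vS in kS.
rewrite big_split /= !count_end /inner /cut -!sum1dep_card.
rewrite big_distrr /= [in RHS]big_mkcond /= [X in (_ = _ + X)%N]big_mkcond /=.
rewrite -!big_split /=; apply: eq_bigr => e _.
by case: (src e \in S); case: (tgt e \in S).
Qed.

Lemma linked_exit S T : linked S -> T \proper S -> (exists x, x \in T) ->
  exists x y, [/\ x \in T, y \in S :\: T & adj x y].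
Proof.
move=> lS /properP[TS [z zS zT]] [x xT].
apply: contrapT => noexit.
have closedT u v : adj_in S u v -> u \in T -> v \in T.
  move=> /and3P[uv _ vS] uT; apply/negPn/negP => vT; apply: noexit.
  by exists u, v; split => //; rewrite inE vT.
have /connectP[p pth zp] := lS x z (fintype.subsetP TS x xT) zS.
suff: z \in T by rewrite (negPf zT).
rewrite zp; elim: p x xT pth {zp} => //= w p IH x xT /andP[/closedT cl pth].
exact: IH (cl xT) pth.
Qed.

Lemma inner_setU1 T x y : x \in T -> y \notin T -> adj x y ->
  (inner T < inner (y |: T))%N.
Proof.
move=> xT yT /existsP[e se]; apply: proper_card; apply/properP; split.
  apply/fintype.subsetP => e'; rewrite !inE => /andP[-> ->].
  by rewrite !orbT.
by exists e; rewrite !inE; case/orP: se => /andP[/eqP-> /eqP->];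
  rewrite ?eqxx ?xT ?(negPf yT) ?orbT ?andbF.
Qed.

(** A connected graph has at least as many edges as a spanning tree: in a
    largest subset satisfying the bound there is room, unless it is [S], for
    one more vertex together with an edge attaching it. *)
Lemma linked_card S : linked S -> (#|S| <= (inner S).+1)%N.
Proof.
move=> lS; have [->|[x xS]] := set_0Vmem S; first by rewrite cards0.
pose P T := [&& T \subset S, x \in T & #|T| <= (inner T).+1]%N.
have P1 : P [set x]%SET by rewrite /P finset.sub1set xS inE eqxx cards1.
case: (arg_maxnP (fun T : {set vert G} => #|T|) P1) => T /and3P[TS xT cT] maxT.
have [<-//|neTS] := eqVneq T S.
have prTS : T \proper S by rewrite finset.properEneq neTS TS.
have [u [v [uT /setDP[vS vT] uv]]] := linked_exit lS prTS (ex_intro _ x xT).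
have := maxT (v |: T)%SET; rewrite cardsU1 vT /P => /(_ _)/wrap[].
  rewrite finset.subUset finset.sub1set vS TS in_setU1 xT orbT /=.
  by rewrite cardsU1 vT; have := inner_setU1 uT vT uv; lia.
by rewrite /=; lia.
Qed.

Lemma linked_cut S : linked S -> (cut S + 2 * #|S| <= \sum_(v in S) deg v + 2)%N.
Proof. by move=> /linked_card; rewrite sum_deg; lia. Qed.

Definition comp S u : {set vert G} := [set y | connect (adj_in S) u y].

Lemma adj_in_subset S T x y : S \subset T ->
  connect (adj_in S) x y -> connect (adj_in T) x y.
Proof.
move=> /fintype.subsetP ST; apply: connect_sub => {}x {}y /and3P[xy /ST xT /ST yT].
by apply: connect1; apply/and3P.
Qed.

Lemma comp_subset S u : u \in S -> comp S u \subset S.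
Proof.
move=> uS; apply/fintype.subsetP => y; rewrite inE => /connectP[p].
elim: p u uS => [|w p IH] u uS /= => [_ -> //|/andP[/and3P[_ _ wS]]].
exact: IH.
Qed.

Lemma connect_comp S u x : connect (adj_in S) u x -> connect (adj_in (comp S u)) u x.
Proof.
move=> /connectP[p]; elim/last_ind: p x => [x _ -> //|p w IH x].
rewrite rcons_path last_rcons => /andP[pth lw] ->.
have lc := IH _ pth erefl; apply: connect_trans lc (connect1 _).
case/and3P: (lw) => lwa _ _; rewrite /adj_in lwa !inE.
have lc : connect (adj_in S) u (last u p) by apply/connectP; exists p.
by rewrite lc (connect_trans lc (connect1 lw)).
Qed.

Lemma linked_comp S u : linked (comp S u).
Proof.
move=> x y; rewrite !inE => /connect_comp ux /connect_comp uy.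
by rewrite (connect_trans _ uy) // adj_in_connect_sym.
Qed.

(** Follow a simple path from [v] to [y]: it leaves [v] at once and never
    comes back. *)
Lemma linked_remove A v y : linked A -> v \in A -> y \in A :\ v ->
  exists u, [/\ adj v u, u \in A :\ v & y \in comp (A :\ v) u].
Proof.
move=> lA vA /setD1P[yv yA]; have /connectP[p0 pth0 yp0] := lA v y vA yA.
move: yp0 yv; case/shortenP: pth0 => p pth up _ yp yv.
case: p pth up yp => [_ _ yp|u p /= /andP[/and3P[vu _ uA] pth]]; first by rewrite yp eqxx in yv.
move=> /and3P[vup _ _] yp; exists u.
have uv : u != v by apply: contraNneq vup => ->; rewrite inE eqxx.
rewrite vu !inE uv uA; split => //; apply/connectP; exists p => //.
move: vup; rewrite inE negb_or => /andP[_] vp {yp yv}.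
elim: p u uv uA pth vp {vu} => //= w p IH u uv uA /andP[/and3P[uw _ wA] pth].
rewrite inE negb_or => /andP[vw vp]; rewrite IH // 1?eq_sym // andbT.
by rewrite /adj_in uw !inE uv uA eq_sym vw.
Qed.

Lemma card_adj v : (#|[set u | adj v u]| <= deg v)%N.
Proof.
pose P := [set e : edge G | src e == v]; pose Q := [set e : edge G | tgt e == v].
apply: leq_trans (leq_add (leq_imset_card (@tgt G) P) (leq_imset_card (@src G) Q)).
apply: leq_trans (leq_card_setU _ _); apply/subset_leq_card/fintype.subsetP => u.
rewrite !inE => /existsP[e /orP[] /andP[/eqP es /eqP et]]; apply/orP; [left|right].
  by apply/imsetP; exists e; rewrite ?inE ?es.
by apply/imsetP; exists e; rewrite ?inE ?et.
Qed.

(** The components of [A :\ v] are those of the neighbours of [v], of which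
    there are at most [deg v]. *)
Lemma sum_remove_le A v (w : vert G -> nat) B : linked A -> v \in A ->
  {in A :\ v, forall u, adj v u -> \sum_(x in comp (A :\ v) u) w x <= B}%N ->
  (\sum_(x in A) w x <= w v + deg v * B)%N.
Proof.
move=> lA vA wB; rewrite (big_setD1 v) //= leq_add2l.
pose N := [set u in A :\ v | adj v u].
have NB : (\sum_(u in N) \sum_(x in comp (A :\ v) u) w x <= deg v * B)%N.
  apply: leq_trans (_ : #|N| * B <= _)%N; last first.
    rewrite leq_mul2r (leq_trans _ (card_adj v)) ?orbT //.
    by apply/subset_leq_card/fintype.subsetP => u; rewrite !inE => /andP[].
  rewrite -sum_nat_const; apply: leq_sum => u; rewrite inE => /andP[uA vu].
  exact: wB.
apply: leq_trans NB.
under [leqRHS]eq_bigr do rewrite big_mkcond.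
rewrite exchange_big /= [leqLHS]big_mkcond; apply: leq_sum => y _.
case: ifP => // yA; have [u [vu uA yu]] := linked_remove lA vA yA.
by rewrite (bigD1 u) /= ?yu ?leq_addr // /N inE uA.
Qed.

Lemma linked_setU S T x y : linked S -> linked T -> x \in S -> y \in T ->
  adj x y -> linked (S :|: T).
Proof.
move=> lS lT xS yT xy.
have toS u : u \in S -> connect (adj_in (S :|: T)) x u.
  move=> uS; apply: adj_in_subset (lS _ _ xS uS); exact: finset.subsetUl.
have toT u : u \in T -> connect (adj_in (S :|: T)) x u.
  move=> uT; apply: connect_trans (adj_in_subset (finset.subsetUr _ _) (lT _ _ yT uT)).
  by apply: connect1; rewrite /adj_in xy !inE xS yT orbT.
have toU u : u \in S :|: T -> connect (adj_in (S :|: T)) x u.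
  by move=> /setUP[/toS|/toT].
move=> u u' /toU xu /toU; apply: connect_trans.
by rewrite adj_in_connect_sym.
Qed.

(** The other components of [A :\ v] remain attached to [v]. *)
Lemma linked_remove_comp A v u : linked A -> v \in A -> u \in A :\ v ->
  linked (A :\: comp (A :\ v) u).
Proof.
move=> lA vA uA.
set C := comp (A :\ v) u.
have CA : C \subset A :\ v by exact: comp_subset.
have vC : v \notin C by apply/negP => /(fintype.subsetP CA); rewrite !inE eqxx.
have reach y : y \in A :\: C -> connect (adj_in (A :\: C)) v y.
  move=> /setDP[yA yC]; have [->|yv] := eqVneq y v; first exact: connect0.
  have yA' : y \in A :\ v by rewrite !inE yv.
  have [t [vt tA yt]] := linked_remove lA vA yA'.
  have CtC : comp (A :\ v) t \subset A :\: C.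
    apply/fintype.subsetP => z zt.
    have /setD1P[_ zA] := fintype.subsetP (comp_subset tA) _ zt.
    rewrite !inE zA andbT.
    apply: contra yC; rewrite !inE in yt zt * => uz.
    by apply: connect_trans uz _; apply: connect_trans yt; rewrite adj_in_connect_sym.
  have tC : t \in A :\: C by apply: (fintype.subsetP CtC); rewrite inE connect0.
  have tt : t \in comp (A :\ v) t by rewrite inE connect0.
  apply: connect_trans (adj_in_subset CtC (linked_comp tt yt)).
  by apply: connect1; rewrite /adj_in vt tC finset.in_setD vA vC.
move=> x y /reach vx /reach vy; apply: connect_trans vy.
by rewrite adj_in_connect_sym.
Qed.

(** A smallest admissible [A] is light enough. Otherwise, pick [v] in [A] next
    to the rest of [S]; as [v] has degree at most 3, some component of
    [A :\ v] still weighs [M], and it can replace [A], for what it leaves of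
    [A] hangs on to [v]. *)
Lemma linked_peel (w : vert G -> nat) (M : nat) S :
  (forall v, deg v <= 3)%N -> (forall v, w v <= 1)%N -> (0 < M)%N ->
  linked S -> (M <= \sum_(x in S) w x)%N ->
  exists A, [/\ A \subset S, linked A, linked (S :\: A)
    & M <= \sum_(x in A) w x <= 3 * M]%N.
Proof.
move=> deg3 w1 M0 lS wS.
pose P A := `[< [/\ A \subset S, linked A, linked (S :\: A) & M <= \sum_(x in A) w x]%N >].
have PS : P S.
  by apply/asboolP; split => //; rewrite finset.setDv => x y; rewrite inE.
case: (arg_minnP (fun A : {set vert G} => #|A|) PS) => A /asboolP[AS lA lSA wA] minA.
exists A; split => //; rewrite wA /=.
rewrite leqNgt; apply/negP => bigA.
have [v vA vexit] : exists2 v, v \in A &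
    S :\: A = finset.set0 \/ exists2 z, z \in S :\: A & adj v z.
  have [a aA] : exists a, a \in A.
    apply/set0Pn; apply: contraTneq bigA => ->; rewrite big_set0; lia.
  have [SA|ne] := eqVneq (S :\: A) finset.set0; first by exists a; [|left].
  have pAS : A \proper S by rewrite fintype.properE AS -finset.setD_eq0.
  have [x [z [xA zS xz]]] := linked_exit lS pAS (ex_intro _ a aA).
  by exists x => //; right; exists z.
have [u [uA wu]] : exists u, u \in A :\ v /\ (M <= \sum_(x in comp (A :\ v) u) w x)%N.
  apply: contrapT => small.
  have := @sum_remove_le A v w M.-1 lA vA; move=> /(_ _)/wrap[|].
    move=> u uA _; rewrite -ltnS prednK // ltnNge; apply/negP => wu.
    by apply: small; exists u.
  have := deg3 v; have := w1 v; nia.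
pose C := comp (A :\ v) u.
have CA' : C \subset A :\ v by exact: comp_subset.
have CA : C \proper A.
  apply: sub_proper_trans CA' _; exact: properD1.
have : P C.
  apply/asboolP; split => //.
  - exact: fintype.subset_trans (proper_sub CA) AS.
  - exact: linked_comp.
  - have lAC := linked_remove_comp lA vA uA.
    case: vexit => [SA|[z zSA vz]].
      suff -> : S = A by [].
      by apply/eqP; rewrite finset.eqEsubset AS -finset.setD_eq0 SA eqxx.
    have -> : S :\: C = (A :\: C) :|: (S :\: A).
      apply/setP => x; rewrite !finset.in_setD !finset.in_setU !finset.in_setD.
      have := fintype.subsetP AS x; have := fintype.subsetP (proper_sub CA) x.
      by case: (x \in S); case: (x \in A); case: (x \in C) => //= h1 h2;
         (by have := h1 isT) || (by have := h2 isT).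
    apply: linked_setU lAC lSA _ zSA vz.
    by rewrite finset.in_setD vA andbT; apply/negP => /(fintype.subsetP CA'); rewrite !inE eqxx.
by move/minA; rewrite leqNgt (proper_card CA).
Qed.

Hypothesis deg_int : forall v, v \notin bdry G -> deg v = 3%N.
Hypothesis deg_bdry : forall v, v \in bdry G -> deg v = 1%N.

(** Degrees are 3 and 1, so the sum over [S] of [deg v - 2] is the number of
    interior vertices minus the number of boundary vertices. *)
Lemma linked_cut_bdry S : linked S ->
  (cut S + #|S :&: bdry G| <= #|S :\: bdry G| + 2)%N.
Proof.
move=> /linked_cut; rewrite -(cardsID (bdry G) S) (big_setID (bdry G)) /=.
rewrite (eq_bigr (fun=> 1%N)); last by move=> v /setIP[_ /deg_bdry].
rewrite [X in (_ + X + 2)%N](eq_bigr (fun=> 3%N)); last by move=> v /setDP[_ /deg_int].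
by rewrite !sum_nat_const; lia.
Qed.

(** If every connected piece of moderate size has a large edge boundary, then
    [S] must have many more interior than boundary vertices. Induct by peeling
    off a piece: as its edge boundary is large, [linked_cut_bdry] gives it an
    excess of interior vertices proportional to its boundary vertices, and
    these excesses add up. With [8 * K] boundary vertices in a piece, the
    constant 2 of [linked_cut_bdry] costs at most a quarter of this excess. A
    last piece too light to be peeled is absorbed by the term [32 * K]. *)
Lemma bdry_le_interior K S : (0 < K)%N ->
  (forall A, linked A -> 8 * K <= #|A :&: bdry G| <= 24 * K ->
    #|A :&: bdry G| < K * cut A)%N ->
  linked S ->
  (3 * #|S :&: bdry G| + 4 * K * #|S :&: bdry G|
    <= 4 * K * (#|S :\: bdry G| + 2) + 32 * K)%N.
Proof.
move=> K0 cutA; have [m] := ubnP #|S|; elim: m S => // m IH S Sm lS.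
have cS := linked_cut_bdry lS.
have [|bigS] := ltnP #|S :&: bdry G| (8 * K); first by nia.
pose w v : nat := (v \in bdry G).
have sum_w T : (\sum_(x in T) w x = #|T :&: bdry G|)%N.
  rewrite -sum1_card [RHS](eq_bigl (fun x => (x \in T) && (x \in bdry G))).
    by rewrite [RHS]big_mkcondr; apply: eq_bigr.
  by move=> x; rewrite inE.
have deg3 v : (deg v <= 3)%N.
  by have [/deg_bdry->|/deg_int->] := boolP (v \in bdry G).
have [A [AS lA lSA]] : exists A, [/\ A \subset S, linked A, linked (S :\: A)
    & 8 * K <= \sum_(x in A) w x <= 3 * (8 * K)]%N.
  apply: linked_peel => //; first by move=> v; rewrite /w; case: (v \in _).
    by rewrite muln_gt0.
  by rewrite sum_w.
rewrite sum_w mulnA => wA; have := cutA A lA wA; have := linked_cut_bdry lA.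
have SAm : (#|S :\: A| < m)%N.
  have : (0 < #|A|)%N.
    have : (0 < #|A :&: bdry G|)%N by lia.
    by move=> /leq_trans; apply; apply/subset_leq_card/finset.subsetIl.
  move: Sm; rewrite -(cardsID A S) (finset.setIidPr AS); lia.
have := IH _ SAm lSA.
have -> : (#|S :&: bdry G| = #|A :&: bdry G| + #|(S :\: A) :&: bdry G|)%N.
  rewrite -(cardsID A (S :&: bdry G)) finset.setIAC (finset.setIidPr AS).
  by rewrite finset.setIDAC.
have -> : (#|S :\: bdry G| = #|A :\: bdry G| + #|(S :\: A) :\: bdry G|)%N.
  rewrite -(cardsID A (S :\: bdry G)) finset.setIDAC (finset.setIidPr AS).
  by rewrite !finset.setDDl finset.setUC.
nia.
Qed.

(** For [S] the whole graph the excess of interior vertices is [2 * g - 2], too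
    small for [bdry_le_interior] once [n] is large compared with [K * g]. The
    pieces have at most [24 * K] boundary vertices, less than half of [n]. *)
Lemma sparse_cut g n K : (0 < g)%N -> (0 < K)%N -> (50 * K * g <= n)%N ->
  connected_graph G ->
  #|~: bdry G| = (2 * g + n - 2)%N -> #|bdry G| = n ->
  exists A, [/\ (K * cut A <= #|A :&: bdry G|)%N, (0 < #|A :&: bdry G|)%N
    & (2 * #|A :&: bdry G| <= n)%N].
Proof.
move=> g0 K0 nbig conn nint nbdry; apply: contrapT => nocut.
have lT : linked [set: vert G].
  move=> x y _ _; apply: connect_sub (conn x y) => {}x {}y xy.
  by apply: connect1; rewrite /adj_in xy !inE.
have : (3 * #|[set: vert G] :&: bdry G| + 4 * K * #|[set: vert G] :&: bdry G|
    <= 4 * K * (#|[set: vert G] :\: bdry G| + 2) + 32 * K)%N.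
  apply: bdry_le_interior => // A lA /andP[A8 A24].
  rewrite ltnNge; apply/negP => cA; apply: nocut; exists A; split => //; nia.
rewrite finset.setTI finset.setTD nint nbdry; nia.
Qed.

End Cuts.

Local Open Scope classical_set_scope.
Local Open Scope ring_scope.

(** * The second entry of an ordered spectrum *)

(** The finiteness of the support of [mult] guarantees that there is an ordered
    list with these multiplicities; its two first entries are nonnegative and,
    as 0 and [x > 0] both occur in it, the second one is at most [x]. *)
Lemma kth_eigenvalue1_bounds (R : realType) (mult : R -> nat) (x : R) :
  finite_set [set y | mult y != 0%N] ->
  (forall y, mult y != 0%N -> 0 <= y) -> mult 0 != 0%N ->
  0 < x -> mult x != 0%N -> 0 <= kth_eigenvalue mult 1 <= x.
Proof.
move=> /finite_seqP[t0 Et] mult_ge0 m0 x0 mx.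
pose t := undup t0; pose s := sort <=%R (flatten [seq nseq (mult y) y | y <- t]).
have ut : uniq t by exact: undup_uniq.
have memt y : (y \in t) = (mult y != 0%N).
  have Ey : (mult y != 0%N) = (y \in t0) :> Prop := f_equal (@^~ y) Et.
  by rewrite mem_undup; apply/idP/idP; rewrite Ey.
have cs y : count_mem y s = mult y.
  rewrite (permP (permEl (perm_sort _ _))) count_flatten -map_comp sumnE big_map.
  have cn z : (count_mem y \o (fun z => nseq (mult z) z)) z = ((z == y) * mult z)%N.
    by rewrite /= count_nseq /=.
  under eq_bigr do rewrite cn.
  have [yt|] := boolP (y \in t).
    rewrite (bigD1_seq y) //= eqxx mul1n big1 ?addn0 // => z /negPf->.
    by rewrite mul0n.
  move=> yt; rewrite big1_seq; first by move: yt; rewrite memt negbK => /eqP.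
  move=> z /andP[_ zt]; case: eqP => [zy|]; last by rewrite mul0n.
  by rewrite zy (negPf yt) in zt.
have ss : ordered_spectrum mult s.
  by split=> //; apply: sort_sorted; exact: le_total.
rewrite /kth_eigenvalue.
have -> : xget [::] [set s0 | ordered_spectrum mult s0] = s.
  apply: ordered_spectrum_unique (ss).
  by apply: (xgetPex _ (P := [set s0 | ordered_spectrum mult s0])); exists s.
have ms y : (y \in s) = (mult y != 0%N) by rewrite -has_pred1 has_count cs lt0n.
case: ss => srt _; clear cs; clearbody s.
case: s srt ms => [|a [|b s]] srt ms.
- by move: (ms 0); rewrite m0.
- move: (ms 0) (ms x); rewrite m0 mx !inE => /eqP oa /eqP xa.
  by rewrite xa -oa ltxx in x0.
- rewrite /= mult_ge0 -?ms ?inE ?eqxx ?orbT //=.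
  rewrite leNgt; apply/negP => xb.
  have big y : y \in b :: s -> b <= y.
    move: srt => /= /andP[_ pth]; rewrite inE => /predU1P[->//|ys].
    by move: pth; rewrite (path_sortedE le_trans) => /andP[/allP/(_ y ys)].
  have isa y : y < b -> y \in [:: a, b & s] -> y = a.
    by move=> yb; rewrite inE => /predU1P[//|/big]; rewrite leNgt yb.
  have x_a : x = a by apply: isa => //; rewrite ms mx.
  have o_a : 0 = a by apply: isa (lt_trans x0 xb) _; rewrite ms m0.
  by rewrite x_a -o_a ltxx in x0.
Qed.

(** * Energy, mass and their generalised eigenfunctions *)

Section Dirichlet.
Variables (R : realType) (G : bgraph) (m : vert G -> nat).
Implicit Types (f h : vert G -> R) (x : R) (v : vert G).

(** The sign is opposite to that of [laplacian], so that [lap] is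
    nonnegative. *)
Definition lap f v : R := \sum_(e | src e == v) (f v - f (tgt e))
  + \sum_(e | tgt e == v) (f v - f (src e)).

Definition dir f h : R :=
  \sum_e (f (src e) - f (tgt e)) * (h (src e) - h (tgt e)).

Definition mass f h : R := \sum_v (m v)%:R * f v * h v.

Definition eigenfunction x f := forall v, lap f v = x * (m v)%:R * f v.

Lemma green f h : \sum_v lap f v * h v = dir f h.
Proof.
have regroup (k l : edge G -> vert G) :
    \sum_v (\sum_(e | k e == v) (f v - f (l e))) * h v
    = \sum_e (f (k e) - f (l e)) * h (k e).
  rewrite [RHS](partition_big k predT) //=; apply: eq_bigr => v _.
  by rewrite mulr_suml; apply: eq_bigr => e /eqP->.
under eq_bigr do rewrite mulrDl.
rewrite big_split /= !regroup -big_split; apply: eq_bigr => e _ /=; ring.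
Qed.

Lemma dirC f h : dir f h = dir h f.
Proof. by apply: eq_bigr => e _; rewrite mulrC. Qed.

Lemma massC f h : mass f h = mass h f.
Proof. by apply: eq_bigr => v _; rewrite mulrAC. Qed.

Lemma dir_ge0 f : 0 <= dir f f.
Proof. by apply: sumr_ge0 => e _; rewrite -expr2 sqr_ge0. Qed.

Lemma mass_ge0 f : 0 <= mass f f.
Proof.
by apply: sumr_ge0 => v _; rewrite -mulrA mulr_ge0 // -expr2 sqr_ge0.
Qed.

Lemma eigenfunction_dir x f h : eigenfunction x f -> dir f h = x * mass f h.
Proof.
move=> ef; rewrite -green mulr_sumr; apply: eq_bigr => v _.
by rewrite ef !mulrA.
Qed.

Lemma dirDZ f h t : dir (fun v => f v + t * h v) (fun v => f v + t * h v)
  = dir f f + 2 * t * dir f h + t ^+ 2 * dir h h.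
Proof.
rewrite !mulr_sumr -!big_split; apply: eq_bigr => e _ /=; ring.
Qed.

Lemma massDZ f h t : mass (fun v => f v + t * h v) (fun v => f v + t * h v)
  = mass f f + 2 * t * mass f h + t ^+ 2 * mass h h.
Proof.
rewrite !mulr_sumr -!big_split; apply: eq_bigr => e _ /=; ring.
Qed.

Lemma mass_eigen_orth x y f h : eigenfunction x f -> eigenfunction y h ->
  x != y -> mass f h = 0.
Proof.
move=> /eigenfunction_dir ef /eigenfunction_dir eh xy.
have /eqP := ef h; rewrite dirC eh massC -subr_eq0 -mulrBl mulf_eq0.
by rewrite subr_eq0 eq_sym (negPf xy) => /eqP.
Qed.

Hypothesis conn : connected_graph G.

Lemma dir_eq0 f : dir f f = 0 -> forall u v, f u = f v.
Proof.
move=> d0 u v.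
have edge0 e : f (src e) = f (tgt e).
  apply/eqP; rewrite -subr_eq0 -[_ == 0]sqrf_eq0 expr2.
  by have /psumr_eq0P-> := d0; rewrite // => e' _; rewrite -expr2 sqr_ge0.
have /connectP[p] := conn u v; elim: p u => [|w p IH] u /=; first by move=> _ ->.
move=> /andP[/existsP[e se] pth vp]; rewrite -(IH w pth vp).
by case/orP: se => /andP[/eqP<- /eqP<-]; rewrite edge0.
Qed.

(** Along an edge [f] varies by at most 1, and a simple path has at most
    [#|vert G|] edges. *)
Lemma sup_bound f v0 v : dir f f <= 1 -> `|f v0| <= 1 -> `|f v| <= 1 + #|vert G|%:R.
Proof.
move=> d1 f0.
have edge1 u w : adj u w -> `|f u - f w| <= 1.
  move=> /existsP[e se].
  have {se} -> : `|f u - f w| = `|f (src e) - f (tgt e)|.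
    by case/orP: se => /andP[/eqP-> /eqP->] //; rewrite distrC.
  rewrite -(@expr_le1 _ 2) // real_normK ?num_real // expr2.
  apply: le_trans d1; rewrite /dir (bigD1 e) //= lerDl sumr_ge0 // => e' _.
  by rewrite -expr2 sqr_ge0.
have /connectP[p0 pth0] := conn v0 v.
case/shortenP: pth0 => p pth up _ ->.
apply: (@le_trans _ _ (1 + (size p)%:R)); last first.
  rewrite lerD2l ler_nat; have := max_card (mem (v0 :: p)).
  by rewrite (card_uniqP up) => /ltnW.
elim/last_ind: p pth {up} => [|p w IH]; first by rewrite /= addr0.
rewrite rcons_path last_rcons size_rcons => /andP[/IH{}IH /edge1].
have := ler_normB (f (last v0 p)) (f (last v0 p) - f w).
rewrite opprB addrC subrK -natr1; lra.
Qed.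

Notation vfun := (prod_topology (fun _ : vert G => R)).

Lemma continuous_eval v : continuous (fun f : vfun => f v : R).
Proof. exact: (@proj_continuous (vert G) (fun _ => R) v). Qed.

Lemma continuous_dir : continuous (fun f : vfun => dir f f).
Proof.
apply: continuous_big => [|e _ f]; first exact: add_continuous.
have cD : (fun h : vfun => h (src e) - h (tgt e) : R) @ f
    --> (f (src e) - f (tgt e) : R).
  exact: (cvgB (@continuous_eval (src e) f) (@continuous_eval (tgt e) f)).
exact: (cvgM cD cD).
Qed.

Lemma continuous_mass f : continuous (fun h : vfun => mass f h).
Proof.
apply: continuous_big => [|v _ h]; first exact: add_continuous.
exact: (cvgM (cvg_cst _) (@continuous_eval v h)).
Qed.

Lemma continuous_mass_diag : continuous (fun f : vfun => mass f f).
Proof.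
apply: continuous_big => [|v _ f]; first exact: add_continuous.
have cf := @continuous_eval v f.
exact: (cvgM (cvgM (cvg_cst _) cf) cf).
Qed.

Lemma sq_le1_of_mass f v : (0 < m v)%N -> mass f f <= 1 -> `|f v| <= 1.
Proof.
move=> mv f1; rewrite -(@expr_le1 _ 2) // real_normK ?num_real //.
apply: le_trans f1; rewrite /mass (bigD1 v) //=.
apply: ler_wpDr; first by apply: sumr_ge0 => u _; rewrite -mulrA mulr_ge0 // -expr2 sqr_ge0.
by rewrite -mulrA -expr2 ler_peMl ?sqr_ge0 // ler1n.
Qed.

(** The mass is maximised under a bound on the sum of energy and mass, rather
    than the energy minimised at fixed mass, because the former constraint
    defines a compact set even where [m] vanishes. Functions on the vertices
    carry the product topology, so compactness comes from that of a box. *)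
Lemma mass_maximizer v0 : (0 < m v0)%N ->
  exists h, [/\ dir h h + mass h h <= 1, mass (fun=> 1) h = 0
    & forall f, dir f f + mass f f <= 1 -> mass (fun=> 1) f = 0 -> mass f f <= mass h h].
Proof.
move=> m0.
pose K : set vfun := [set f | dir f f + mass f f <= 1] `&` [set f | mass (fun=> 1) f = 0].
have K0 : K !=set0.
  exists (fun=> 0); split => /=; last by apply: big1 => v _; rewrite mulr0.
  rewrite /dir /mass !big1 ?addr0 ?ler01 // => [v|e] _; by rewrite ?subrr mulr0.
have Kcl : closed K.
  apply: closedI.
    apply: (@preimage_closed vfun R (fun f : vfun => dir f f + mass f f) [set x | x <= 1]) => //.
    by move=> f _; exact: (cvgD (@continuous_dir f) (@continuous_mass_diag f)).
  apply: (@preimage_closed vfun R (fun f : vfun => mass (fun=> 1) f) [set x | x = 0]) => //.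
  by move=> f _; apply: continuous_mass.
pose b : R := 1 + #|vert G|%:R.
have Kco : compact K.
  have box := @tychonoff _ (fun _ : vert G => R) (fun=> `[- b, b]%classic)
    (fun=> @segment_compact R _ _).
  apply: subclosed_compact Kcl box _ => f [/= f1 _] v.
  rewrite /= in_itv /= -ler_norml; apply: (@sup_bound f v0).
    by apply: le_trans f1; rewrite lerDl mass_ge0.
  by apply: sq_le1_of_mass m0 _; apply: le_trans f1; rewrite lerDr dir_ge0.
have [h hK hmax] := @compact_EVT_max vfun R (fun f => mass f f) K K0 Kco
  (continuous_subspaceT continuous_mass_diag).
move: hK; rewrite inE => -[h1 h0]; exists h; split => // f f1 f0.
by apply: hmax; rewrite inE.
Qed.

(** With [b] the maximal mass and [h] a maximiser, the quadratic form
    [b * dir - (1 - b) * mass] is nonnegative on functions of mean zero and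
    vanishes at [h]. Hence [h] is in its kernel, which is the equation of an
    eigenfunction for [(1 - b) / b], and nonnegativity at [f] bounds this
    eigenvalue by the Rayleigh quotient of [f]. *)
Lemma rayleigh_eigen f : 0 < mass f f -> mass (fun=> 1) f = 0 ->
  exists x h, [/\ 0 < x, x * mass f f <= dir f f, eigenfunction x h
     & exists v, h v != 0].
Proof.
move=> Bf Of.
have [v0 m0] : exists v0, (0 < m v0)%N.
  apply: contrapT => nom; move: Bf; rewrite lt_def => /andP[/eqP[]].
  apply: big1 => v _; have [->|mv] := posnP (m v); first by rewrite !mul0r.
  by exfalso; apply: nom; exists v.
have [h [h1 h0 hmax]] := mass_maximizer m0.
set b := mass h h in hmax.
pose q g := b * dir g g - (1 - b) * mass g g.
(* By homogeneity, rescale [g] to satisfy the constraint. *)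
have q_ge0 g : mass (fun=> 1) g = 0 -> 0 <= q g.
  move=> Og; suff : mass g g <= b * (dir g g + mass g g) by rewrite /q; lra.
  have dg := dir_ge0 g; have mg := mass_ge0 g.
  have [s0|s0] := eqVneq (dir g g + mass g g) 0.
    by rewrite s0 mulr0; lra.
  have {}s0 : 0 < dir g g + mass g g by rewrite lt_def s0 addr_ge0.
  rewrite -ler_pdivrMr //.
  pose c := (Num.sqrt (dir g g + mass g g))^-1.
  have c2 : c ^+ 2 = (dir g g + mass g g)^-1 by rewrite exprVn sqr_sqrtr // ltW.
  have dirc : dir (fun v => c * g v) (fun v => c * g v) = c ^+ 2 * dir g g.
    by rewrite mulr_sumr; apply: eq_bigr => e _; ring.
  have massc : mass (fun v => c * g v) (fun v => c * g v) = c ^+ 2 * mass g g.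
    by rewrite mulr_sumr; apply: eq_bigr => e _; ring.
  rewrite mulrC -c2 -massc; apply: hmax.
    by rewrite dirc massc c2 -mulrDr mulVf // gt_eqF.
  transitivity (c * mass (fun=> 1) g); last by rewrite Og mulr0.
  by rewrite mulr_sumr; apply: eq_bigr => v _; ring.
have b0 : 0 < b.
  rewrite lt_def mass_ge0 andbT; apply/eqP => b0.
  by have := q_ge0 f Of; rewrite /q b0; lra.
have qh : q h <= 0.
  suff : b * (dir h h + b - 1) <= 0 by rewrite /q -/b; lra.
  by rewrite pmulr_rle0 //; move: h1; rewrite -/b; lra.
(* The polar form of [q] vanishes at [h], for otherwise [q] would be negative
   at [h + t * g] for the [t] below, in which [c + 1] rather than [c] allows
   for [q g = 0]. *)
have polar g : mass (fun=> 1) g = 0 -> b * dir h g = (1 - b) * mass h g.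
  move=> Og; set l := b * dir h g - (1 - b) * mass h g.
  suff l0 : l = 0 by apply/eqP; rewrite -subr_eq0 -/l l0.
  have qg := q_ge0 g Og; set c := q g in qg.
  have := q_ge0 (fun v => h v + (- l / (c + 1)) * g v).
  rewrite /q dirDZ massDZ -/b => /(_ _)/wrap[].
    transitivity (mass (fun=> 1) h + - l / (c + 1) * mass (fun=> 1) g).
      by rewrite mulr_sumr -big_split; apply: eq_bigr => v _ /=; ring.
    by rewrite h0 Og mulr0 addr0.
  set t := - l / (c + 1) => qt.
  have c1 : 0 < c + 1 by lra.
  have qt' : 0 <= 2 * t * l + t ^+ 2 * c.
    move: qt qh; rewrite /q /l /c /q -/b; lra.
  have tl : l = - t * (c + 1) by rewrite /t; field; lra.
  have : 0 <= - (t ^+ 2 * (c + 2)).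
    by apply: le_trans qt' _; rewrite tl; lra.
  rewrite oppr_ge0 pmulr_lle0; last by lra.
  by rewrite real_exprn_even_le0 ?num_real //= => /eqP t0; rewrite tl t0 oppr0 mul0r.
have M0 : 0 < \sum_v (m v)%:R :> R.
  rewrite (bigD1 v0) //=; apply: ltr_wpDr; last by rewrite ltr0n.
  exact: sumr_ge0.
(* Test [polar] on the indicator of [v] minus its mean [c]. *)
have eigh : eigenfunction ((1 - b) / b) h.
  move=> v; pose c := (m v)%:R / \sum_v (m v)%:R : R.
  have delta (F : vert G -> R) : \sum_u F u * (u == v)%:R = F v.
    rewrite (bigD1 v) //= eqxx mulr1 big1 ?addr0 // => u /negPf->.
    by rewrite mulr0.
  have := polar (fun u => (u == v)%:R - c) => /(_ _)/wrap[].
    rewrite /mass; under eq_bigr do rewrite mulr1 mulrBr.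
    rewrite sumrB delta -mulr_suml /c; field; lra.
  have -> : dir h (fun u => (u == v)%:R - c) = lap h v.
    rewrite -[RHS]delta green; apply: eq_bigr => e _; ring.
  have -> : mass h (fun u => (u == v)%:R - c) = (m v)%:R * h v.
    rewrite /mass; under eq_bigr do rewrite mulrBr.
    rewrite sumrB delta -mulr_suml.
    suff -> : \sum_u (m u)%:R * h u = 0 by rewrite mul0r subr0.
    by rewrite -[RHS]h0; apply: eq_bigr => u _; rewrite mulr1.
  move=> E; apply: (mulfI (lt0r_neq0 b0)); rewrite E; field; lra.
exists ((1 - b) / b), h; split => //.
- have dh := eigenfunction_dir h eigh; rewrite -/b in dh.
  rewrite lt_def; apply/andP; split; last first.
    by rewrite -(pmulr_lge0 _ b0) -dh dir_ge0.
  apply/eqP => x0; rewrite x0 mul0r in dh.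
  have hc v : h v = h v0 by apply: dir_eq0.
  have : h v0 * \sum_v (m v)%:R = 0.
    rewrite mulr_sumr -[RHS]h0; apply: eq_bigr => v _; rewrite hc; ring.
  move/eqP; rewrite mulf_eq0 (gt_eqF M0) orbF => /eqP hv0.
  by move: b0; rewrite /b /mass big1 ?ltxx // => v _; rewrite hc hv0 mulr0.
- have := q_ge0 f Of; rewrite /q => qf.
  rewrite mulrAC ler_pdivrMr //; lra.
- apply: contrapT => nz; move: b0; rewrite /b /mass big1 ?ltxx // => v _.
  have [->|hv] := eqVneq (h v) 0; first by rewrite mulr0.
  by exfalso; apply: nz; exists v.
Qed.

(** A function of mass 0 and energy 0 is constant and vanishes where [m] does
    not, hence is 0. *)
Lemma eigen_pos x h : (exists v, 0 < m v)%N -> eigenfunction x h ->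
  (exists v, h v != 0) -> 0 <= x /\ 0 < mass h h.
Proof.
move=> [v0 m0] eh [v hv].
have dh := eigenfunction_dir h eh.
have mh : 0 < mass h h.
  rewrite lt_def mass_ge0 andbT; apply/eqP => mh0.
  rewrite mh0 mulr0 in dh.
  have hc : h v = h v0 by apply: dir_eq0.
  suff: (m v0)%:R * h v0 * h v0 = 0.
    move/eqP; rewrite -mulrA !mulf_eq0 orbb pnatr_eq0 -hc (negPf hv) orbF.
    by rewrite -leqn0 leqNgt m0.
  have /psumr_eq0P-> // := mh0 => u _.
  by rewrite -mulrA mulr_ge0 // -expr2 sqr_ge0.
by split => //; rewrite -(pmulr_lge0 _ mh) -dh dir_ge0.
Qed.

Section Spectrum.
Hypothesis m_pos : (exists v, 0 < m v)%N.
(** Any family of eigenspaces, so as to cover both [laplace_eigenspace] and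
    [steklov_eigenspace]. *)
Variable E : R -> {vspace {ffun vert G -> R^o}}.
Hypothesis EP : forall x (f : {ffun vert G -> R^o}), f \in E x <-> eigenfunction x f.

Lemma dim_eigenP x : reflect (exists f, eigenfunction x f /\ exists v, f v != 0) (\dim (E x) != 0%N).
Proof.
rewrite dimv_eq0 -vpick0; apply: (iffP idP) => [p0|[f [ef [v fv]]]].
  exists (vpick (E x)); split; first by apply/EP; exact: memv_pick.
  apply: contrapT => z; case/eqP: p0; apply/ffunP => v; rewrite ffunE.
  by apply/eqP/negPn/negP => pv; apply: z; exists v.
rewrite vpick0; apply: contraNneq fv => Ex.
have /EP : eigenfunction x (finfun f : {ffun vert G -> R^o}).
  move=> u; rewrite ffunE -ef /lap ffunE.
  by congr (_ + _); apply: eq_bigr => e _; rewrite !ffunE.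
by rewrite Ex memv0 => /eqP/ffunP/(_ v); rewrite !ffunE => ->.
Qed.

(** One eigenfunction per eigenvalue gives an orthogonal family for the mass
    form, hence a free family. *)
Lemma size_eigenvalues (s : seq R) : uniq s -> (forall x, x \in s -> \dim (E x) != 0%N) ->
  (size s <= \dim {:{ffun vert G -> R^o}})%N.
Proof.
move=> us sE; pose X := [tuple of map (fun x => vpick (E x)) (in_tuple s)].
have XE (i : 'I_(size s)) : X`_i = vpick (E s`_i) by rewrite (nth_map 0).
have pick_eig (i : 'I_(size s)) : eigenfunction s`_i (vpick (E s`_i)).
  by apply/EP; exact: memv_pick.
suff /eqP fX : free X by rewrite -[leqLHS](size_tuple X) -fX dimvS // subvf.
apply/freeP => k kX i.
pose hi := vpick (E s`_i).
have mass_hi : 0 < mass hi hi.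
  have [|//] := @eigen_pos s`_i hi m_pos (pick_eig i).
  have : hi != 0 by rewrite vpick0 -dimv_eq0 sE // mem_nth.
  move=> hi0; apply: contrapT => z; case/eqP: hi0; apply/ffunP => v; rewrite ffunE.
  by apply/eqP/negPn/negP => pv; apply: z; exists v.
have : \sum_j k j * mass hi X`_j = 0.
  transitivity (mass hi (\sum_j k j *: X`_j)).
    under eq_bigr do rewrite mulr_sumr.
    rewrite exchange_big; apply: eq_bigr => v _ /=.
    rewrite sum_ffunE mulr_sumr; apply: eq_bigr => j _.
    by rewrite !ffunE /GRing.scale /=; ring.
  by rewrite kX; apply: big1 => v _; rewrite ffunE mulr0.
rewrite (bigD1 i) //= big1 => [|j ji].
  by rewrite addr0 XE => /eqP; rewrite mulf_eq0 (gt_eqF mass_hi) orbF => /eqP.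
rewrite XE (mass_eigen_orth (pick_eig i) (pick_eig j)) ?mulr0 //.
by rewrite nth_uniq // eq_sym.
Qed.

Lemma finite_eigenvalues : finite_set [set x | \dim (E x) != 0%N].
Proof.
apply: contrapT => /(infinite_set_fset (\dim {:{ffun vert G -> R^o}}).+1)[B BE].
apply/negP; rewrite -leqNgt; apply: size_eigenvalues; first exact: finmap.fset_uniq.
by move=> x xB; apply: BE.
Qed.

Lemma kth_eigenvalue1_le (f : vert G -> R) (t : R) :
  0 < mass f f -> mass (fun=> 1) f = 0 -> dir f f <= t * mass f f ->
  0 <= kth_eigenvalue (fun x : R => \dim (E x)) 1 <= t.
Proof.
move=> mf f0 ft; have [x [h [x0 xf eh hn]]] := rayleigh_eigen mf f0.
have /andP[-> /=] : 0 <= kth_eigenvalue (fun x : R => \dim (E x)) 1 <= x.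
  apply: kth_eigenvalue1_bounds => //; first exact: finite_eigenvalues.
  - by move=> y /dim_eigenP[k [ek kn]]; have [] := eigen_pos m_pos ek kn.
  - apply/dim_eigenP; exists (fun=> 1); split.
      move=> v; rewrite !mul0r /lap !big1 ?addr0 // => e _; by rewrite subrr.
    by have [v _] := m_pos; exists v; rewrite oner_neq0.
  - by apply/dim_eigenP; exists h.
move/le_trans; apply; rewrite -(ler_pM2r mf); exact: le_trans ft.
Qed.

(** The test function is the indicator of [A] minus its mean [c]. Its energy is
    [cut A] and its mass [a * a' / (a + a')], at least half the smaller of the
    weights [a] and [a'] of [A] and of its complement. *)
Lemma kth_eigenvalue1_cut (A : {set vert G}) (w K : nat) :
  (0 < K)%N -> (0 < w)%N -> (K * cut A <= w)%N ->
  (w <= \sum_(v in A) m v)%N -> (w <= \sum_(v in ~: A) m v)%N ->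
  0 <= kth_eigenvalue (fun x : R => \dim (E x)) 1 <= 2 / K%:R.
Proof.
move=> K0 w0 Kc wA wA'.
set a := (\sum_(v in A) m v)%N in wA; set a' := (\sum_(v in ~: A) m v)%N in wA'.
have M0 : 0 < a%:R + a'%:R :> R by rewrite -natrD ltr0n; lia.
pose c : R := a%:R / (a%:R + a'%:R).
pose f v : R := (v \in A)%:R - c.
have sumA (F : vert G -> R) : \sum_v F v = \sum_(v in A) F v + \sum_(v in ~: A) F v.
  by rewrite (bigID (mem A)) /=; congr (_ + _); apply: eq_bigl => v; rewrite !inE.
have massE (h : vert G -> R) d d' : (forall v, h v = if v \in A then d else d') ->
    \sum_v (m v)%:R * h v = d * a%:R + d' * a'%:R.
  move=> hE; rewrite sumA; congr (_ + _); rewrite natr_sum mulr_sumr.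
    by apply: eq_bigr => v vA; rewrite hE vA mulrC.
  by apply: eq_bigr => v; rewrite inE => /negPf vA; rewrite hE vA mulrC.
have f0 : mass (fun=> 1) f = 0.
  rewrite /mass; under eq_bigr do rewrite mulr1.
  rewrite (massE _ (1 - c) (- c)) => [|v]; first by rewrite /c; field; lra.
  by rewrite /f; case: ifP => _; rewrite ?sub0r.
have ff : mass f f = a%:R * a'%:R / (a%:R + a'%:R).
  rewrite /mass; under eq_bigr do rewrite -mulrA.
  rewrite (massE _ ((1 - c) ^+ 2) (c ^+ 2)) => [|v]; first by rewrite /c; field; lra.
  by rewrite /f; case: ifP => _ /=; ring.
have dff : dir f f = (cut A)%:R.
  rewrite /cut -sum1dep_card natr_sum big_mkcond /=; apply: eq_bigr => e _.
  by rewrite /f; case: (src e \in A); case: (tgt e \in A) => /=; ring.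
have mass_ge : w%:R <= 2 * mass f f.
  rewrite ff mulrA ler_pdivlMr // -natrD -!natrM ler_nat.
  have : (w * a' <= a * a')%N by rewrite leq_mul2r wA orbT.
  have : (w * a <= a' * a)%N by rewrite leq_mul2r wA' orbT.
  lia.
have w0R : 0 < w%:R :> R by rewrite ltr0n.
apply: kth_eigenvalue1_le f0 _; first by lra.
rewrite dff mulrAC ler_pdivlMr ?ltr0n // -natrM mulnC.
by apply: le_trans mass_ge; rewrite ler_nat.
Qed.
End Spectrum.
End Dirichlet.

(** * Laplace and Steklov spectra *)

Section BothSpectra.
Variables (R : realType) (G : bgraph).
Implicit Types (f : vert G -> R) (x y v : vert G).

Lemma lap_laplacian f v : laplacian f v = - ((deg v)%:R^-1 * lap f v).
Proof.
rewrite /laplacian /lap -mulrN opprD -!sumrN.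
by congr (_ * (_ + _)); apply: eq_bigr => e _; rewrite opprB.
Qed.

Lemma laplacian_eq0 f v : deg v != 0%N -> laplacian f v = 0 <-> lap f v = 0.
Proof.
move=> dv; rewrite lap_laplacian; split => [/eqP|->]; last by rewrite mulr0 oppr0.
by rewrite oppr_eq0 mulf_eq0 invr_eq0 pnatr_eq0 (negPf dv) => /eqP.
Qed.

(** The only half-edge at [x] may be the source or the target of its edge; the
    argument for one case, with [k] and [l] for the two end maps, gives the
    other by symmetry. *)
Lemma lap_deg1 f x : deg x = 1%N -> lap f x = normal_derivative f x.
Proof.
rewrite /deg /normal_derivative /neighbour /lap => dx.
have half (k l : edge G -> vert G) : #|[set e | k e == x]%SET| = 1%N -> #|[set e | l e == x]%SET| = 0%N ->
  (forall y, adj x y -> exists2 e, k e = x & l e = y) -> (forall e, adj (k e) (l e)) ->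
  \sum_(e | k e == x) (f x - f (l e)) + \sum_(e | l e == x) (f x - f (k e)) =
    f x - f (odflt x [pick y | adj x y]).
  move=> /eqP/cards1P[e0 ke0] /eqP; rewrite cards_eq0 => /eqP le0 kl ak.
  rewrite [X in _ + X]big_pred0 ?addr0 => [|e]; last first.
    by have /finset.setP/(_ e) := le0; rewrite !inE.
  rewrite (big_pred1 e0) => [|e]; last by have /finset.setP/(_ e) := ke0; rewrite !inE.
  have kx : k e0 = x by apply/eqP; have /finset.setP/(_ e0) := ke0; rewrite !inE eqxx.
  case: pickP => [y /kl[e ke <-]|/(_ (l e0))] /=; last by rewrite -{1}kx ak.
  by have /finset.setP/(_ e) := ke0; rewrite !inE ke eqxx => /esym/eqP->.
have adje e : adj (src e) (tgt e) by apply/existsP; exists e; rewrite !eqxx.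
have inc y : adj x y -> exists e, (src e = x /\ tgt e = y) \/ (src e = y /\ tgt e = x).
  by move=> /existsP[e /orP[] /andP[/eqP ? /eqP ?]]; exists e; [left|right].
have [] : (#|[set e : edge G | src e == x]%SET| = 1 /\ #|[set e : edge G | tgt e == x]%SET| = 0 \/
  #|[set e : edge G | src e == x]%SET| = 0 /\ #|[set e : edge G | tgt e == x]%SET| = 1)%N by lia.
- move=> [s1 t0]; apply: half => // y /inc[e [[]|[_ tx]]]; first by exists e.
  by move/cards0_eq/finset.setP/(_ e): t0; rewrite !inE tx eqxx.
- move=> [s0 t1]; rewrite addrC; apply: half => // [y /inc[e [[sx _]|[]]]|e]; last 2 first.
  + by exists e.
  + by rewrite adj_sym.
  by move/cards0_eq/finset.setP/(_ e): s0; rewrite !inE sx eqxx.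
Qed.

Variables (g n K : nat).
Hypotheses (g0 : (0 < g)%N) (K0 : (0 < K)%N) (nbig : (50 * K * g <= n)%N).
Hypothesis GF : in_F g n G.

Lemma eigenvalue1_le :
  0 <= laplace_eigenvalue R G 1 <= 2 / K%:R /\ 0 <= steklov_eigenvalue R G 1 <= 2 / K%:R.
Proof.
have [_ [conn [nint [nb [dint db]]]]] := GF.
have [A [Kc w0 w2]] := sparse_cut dint db g0 K0 nbig conn nint nb.
have deg0 v : deg v != 0%N.
  by have [/db->|/dint->] := boolP (v \in bdry G).
have n0 : (0 < n)%N by lia.
have [v0 v0b] : exists v0, v0 \in bdry G by apply/set0Pn; rewrite -cards_eq0 nb -lt0n.
have wle (m : vert G -> nat) (B : {set vert G}) : (forall v, v \in bdry G -> 0 < m v)%N ->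
    (#|B :&: bdry G| <= \sum_(v in B) m v)%N.
  move=> mb; rewrite -sum1_card [leqRHS](big_setID (bdry G)) /=.
  apply: leq_trans (leq_addr _ _); apply: leq_sum => v /setIP[_]; exact: mb.
have wC : (#|A :&: bdry G| <= #|~: A :&: bdry G|)%N.
  by have := cardsID A (bdry G); rewrite finset.setDE ![bdry G :&: _]finset.setIC; lia.
have mb : forall v, v \in bdry G -> (0 < deg v)%N by move=> v _; rewrite lt0n.
have mb' : forall v, v \in bdry G -> (0 < (v \in bdry G : nat))%N by move=> v ->.
split.
- apply: (@kth_eigenvalue1_cut R G (@deg G) conn _ _ _ A #|A :&: bdry G|) => //.
  + by exists v0; rewrite lt0n.
  + move=> x f; rewrite laplace_eigenspaceP; split=> ef v; have := ef v; rewrite lap_laplacian opprK.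
      by move=> fv; rewrite mulrAC -fv mulrC mulVKf // pnatr_eq0.
    by move=> ->; rewrite mulrAC [_ * (deg v)%:R]mulrC mulKf // pnatr_eq0.
  + exact: wle.
  + exact: leq_trans (wle _ _ mb).
- apply: (@kth_eigenvalue1_cut R G (fun v => v \in bdry G : nat) conn _ _ _ A #|A :&: bdry G|) => //.
  + by exists v0; rewrite v0b.
  + move=> x f; rewrite steklov_eigenspaceP; split => [[fi fb] v|ef].
      have [vb|vb] := boolP (v \in bdry G).
        by rewrite lap_deg1 ?fb ?mulr1 ?db.
      by rewrite mulr0 mul0r; apply/laplacian_eq0 => //; exact: fi.
    split => v vb; have := ef v; rewrite ?vb ?(negPf vb) /=.
      by rewrite mulr0 mul0r => /laplacian_eq0; exact.
    by rewrite lap_deg1 ?db // mulr1.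
  + exact: wle.
  + exact: leq_trans (wle _ _ mb').
Qed.
End BothSpectra.

Theorem corollary4p3 (R : realType) (n : nat -> nat) (G : nat -> bgraph)
    (n_ge2 : forall g : nat, (1 <= g)%N -> (2 <= n g)%N)
    (n_lim : ((n g)%:R / g%:R : R) @[g --> \oo] --> +oo)
    (G_F : forall g : nat, (1 <= g)%N -> in_F g (n g) (G g)) :
  (laplace_eigenvalue R (G g) 1 @[g --> \oo] --> (0 : R)) /\
  (steklov_eigenvalue R (G g) 1 @[g --> \oo] --> (0 : R)).
Proof.
have bounds K : (0 < K)%N -> \forall g \near \oo,
    0 <= laplace_eigenvalue R (G g) 1 <= 2 / K%:R /\
    0 <= steklov_eigenvalue R (G g) 1 <= 2 / K%:R.
  move=> K0; near=> g.
  have g0 : (0 < g)%N by near: g; exact: nbhs_infty_gt.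
  apply: (eigenvalue1_le R g0 K0 _ (G_F g g0)).
  have : (50 * K)%:R <= (n g)%:R / g%:R :> R.
    by near: g; move/cvgryPge: n_lim; exact.
  by rewrite ler_pdivlMr ?ltr0n // -natrM ler_nat.
have to0 (u : nat -> R) : (forall K, (0 < K)%N -> \forall g \near \oo, 0 <= u g <= 2 / K%:R) ->
    u g @[g --> \oo] --> (0 : R).
  move=> uK; apply/cvgrPdist_lt => e e0.
  have [K Ke] : exists K : nat, 2 / e < K%:R.
    exists (Num.truncn (2 / e)).+1; exact: truncnS_gt.
  have K0 : (0 < K)%N.
    by rewrite -(ltr0n R); apply: lt_trans Ke; rewrite divr_gt0.
  near=> g; rewrite sub0r normrN.
  have /andP[u0 ule] : 0 <= u g <= 2 / K%:R by near: g; exact: uK.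
  rewrite ger0_norm //; apply: le_lt_trans ule _.
  by rewrite ltr_pdivrMr ?ltr0n // -ltr_pdivrMl // mulrC.
by split; apply: to0 => K /bounds; apply: filterS => g [].
Unshelve. all: by end_near.
Qed.
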